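(* Let $t_0>0$, let $\alpha,\beta,\gamma$ be quotients of odd positive integers, let $r_1,r_2\in C([t_0,\infty),(0,\infty))$ satisfy $\int_{t_0}^{\infty}r_1^{-1/\alpha}(s)\,ds<\infty$ and $\int_{t_0}^{\infty}r_2^{-1/\beta}(s)\,ds<\infty$, let $q\in C([t_0,\infty),[0,\infty))$ not vanish eventually, and let $\sigma\in C^1([t_0,\infty),(0,\infty))$ satisfy $\sigma(t)\ge t$ and $\sigma'(t)\ge 0$ for all $t\ge t_0$. Consider the equation $$\left(r_2(t)\left(\left(r_1(t)(y'(t))^{\alpha}\right)'\right)^{\beta}\right)'+q(t)\,y^{\gamma}(\sigma(t))=0,\quad t\ge t_0.\qquad (E)$$ Let $\pi_1(t)=\int_t^{\infty}r_1^{-1/\alpha}(s)\,ds$. Suppose that $$\int_{t_0}^{\infty}r_1^{-\frac1\alpha}(v)\left(\int_{t_0}^{v}r_2^{-\frac1\beta}(u)\left(\int_{t_0}^{u}q(s)\,ds\right)^{\frac1\beta}du\right)^{\frac1\alpha}dv=\infty.$$ If $$\limsup_{t\to\infty}\ \pi_1^{\frac{\gamma}{\beta}}(\sigma(t))\int_{t_0}^{t}r_2^{-\frac1\beta}(u)\left(\int_{t_0}^{u}q(s)\,ds\right)^{\frac1\beta}du>1$$ and $\gamma=\alpha\beta$, then $(E)$ has property A.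
   Context: Powers whose exponents are quotients of odd positive integers are taken as real-valued odd functions, also for negative arguments. ''$q$ does not vanish eventually'' means that $q$ is not identically zero on any half-line $[T,\infty)$. A solution of $(E)$ is a nontrivial real-valued function $y\in C([T_y,\infty),\mathbb{R})$, $T_y\ge t_0$, such that $y$, $r_1(y')^{\alpha}$ and $r_2((r_1(y')^{\alpha})')^{\beta}$ are continuous and differentiable on $[T_y,\infty)$ and $y$ satisfies $(E)$ on $[T_y,\infty)$. Only solutions with $\sup\{|y(t)|:T\le t<\infty\}>0$ for every $T\ge T_y$ are considered, and it is assumed that $(E)$ possesses such solutions. A solution is oscillatory if it has arbitrarily large zeros in $[T_y,\infty)$, and nonoscillatory otherwise. Equation $(E)$ has property A if every solution $y$ is either oscillatory or satisfies $\lim_{t\to\infty}y(t)=0$. *)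

(* Defs.v *)
From Stdlib Require Import Reals Lra.
From Coquelicot Require Import Coquelicot.
Open Scope R_scope.

Definition odd_quotient (a : R) : Prop :=
  exists m n : nat, Nat.Odd m /\ Nat.Odd n /\ a = INR m / INR n.

(* The real-valued odd function x |-> x^a, for a (up to sign) a quotient of odd
   positive integers.  The factor [sign x] also gives the value 0 at x = 0,
   where [Rpower 0 a] would be 1; for x > 0 this is [Rpower x a]. *)
Definition opow (x a : R) : R := sign x * Rpower (Rabs x) a.

Definition halfline (a : R) : R -> Prop := fun t => a <= t.

(* Derivatives on [a, +oo) are taken relative to the half-line ([D_in]), hence
   one-sided at a, so the values of a function to the left of a are
   irrelevant. *)
Definition has_derivative_on (a : R) (f f' : R -> R) : Prop :=
  forall t, a <= t -> D_in f f' (halfline a) t.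

Definition LimSup_infty (f : R -> R) : Rbar :=
  Rbar_glb (fun s => exists T : R,
    s = Lub_Rbar (fun x => exists t, T <= t /\ x = f t)).

(* y solves
     (r2 ((r1 (y')^alpha)')^beta)' + q y^gamma(sigma) = 0   on [Ty, +oo).
   Here y' is the derivative of y, and L1', L2' are the derivatives of
   L1 = r1 (y')^alpha and L2 = r2 (L1')^beta. *)
Definition is_solution (t0 alpha beta gamma : R) (r1 r2 q sigma : R -> R)
    (Ty : R) (y : R -> R) : Prop :=
  t0 <= Ty /\
  (exists t, Ty <= t /\ y t <> 0) /\
  exists y' L1' L2' : R -> R,
    let L1 := fun t => r1 t * opow (y' t) alpha in
    let L2 := fun t => r2 t * opow (L1' t) beta in
    continuous_on (halfline Ty) y /\ has_derivative_on Ty y y' /\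
    continuous_on (halfline Ty) L1 /\ has_derivative_on Ty L1 L1' /\
    continuous_on (halfline Ty) L2 /\ has_derivative_on Ty L2 L2' /\
    forall t, Ty <= t -> L2' t + q t * opow (y (sigma t)) gamma = 0.

Definition is_proper_solution (t0 alpha beta gamma : R) (r1 r2 q sigma : R -> R)
    (Ty : R) (y : R -> R) : Prop :=
  is_solution t0 alpha beta gamma r1 r2 q sigma Ty y /\
  forall T, Ty <= T ->
    Rbar_lt 0 (Lub_Rbar (fun x => exists t, T <= t /\ x = Rabs (y t))).

Definition oscillatory (Ty : R) (y : R -> R) : Prop :=
  forall T, exists t, T <= t /\ Ty <= t /\ y t = 0.

Definition property_A (t0 alpha beta gamma : R) (r1 r2 q sigma : R -> R) : Prop :=
  forall (Ty : R) (y : R -> R),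
    is_proper_solution t0 alpha beta gamma r1 r2 q sigma Ty y ->
    oscillatory Ty y \/ is_lim y p_infty 0.

Definition pi_tail (r : R -> R) (a t : R) : R :=
  RInt_gen (fun s => opow (r s) (- / a)) (at_point t) (Rbar_locally p_infty).

Definition inner_integral (t0 beta : R) (r2 q : R -> R) (t : R) : R :=
  RInt (fun u => opow (r2 u) (- / beta) * opow (RInt q t0 u) (/ beta)) t0 t.

(* Main.v *)
Require Import Defs.
From Stdlib Require Import Reals Lra Classical Ranalysis5.
From Coquelicot Require Import Coquelicot.
Open Scope R_scope.

(** Replacing [y] by [- y] if necessary, a nonoscillatory solution is
    eventually positive.  The equation then makes
    [L2 = r2 ((r1 (y')^alpha)')^beta] nonincreasing, hence eventually of one
    sign.  The sign of [L2] is that of the derivative of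
    [L1 = r1 (y')^alpha], so [L1] is eventually monotone and therefore
    eventually of one sign as well; one step further down, [y] itself is
    eventually monotone.  A positive, eventually monotone function either
    tends to [0] or stays above some [c > 0].

    The second possibility contradicts the divergent triple integral.  As
    [sigma t >= t], also [y (sigma t) >= c], so the equation gives
    [L2' <= - c^gamma q], and one integration yields [L2 <= - k Q] with
    [Q t] the integral of [q] from [t0] to [t].  Solving for [L1'] and
    integrating, then solving for [y'] and integrating again, bounds [L1] and
    then [y] above by negative multiples of the double and of the triple
    integral of the divergence hypothesis ([solve_bound],
    [derivative_bound_integrated]).  Hence [y] becomes negative.

    Each integration absorbs its constant of integration by halving the factor
    [k], which requires [Q] and the double integral to tend to infinity too.
    This is where the integrability of [r1^(-1/alpha)] and [r2^(-1/beta)]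
    enters: an integral of an integrable weight against a bounded function is
    bounded ([weighted_divergence]). *)

(** * Odd powers *)

Lemma odd_quotient_pos (a : R) : odd_quotient a -> 0 < a.
Proof.
  intros (m & n & [i Hm] & [j Hn] & ->).
  apply Rdiv_lt_0_compat; apply lt_0_INR; subst;
    rewrite PeanoNat.Nat.add_1_r; apply PeanoNat.Nat.lt_0_succ.
Qed.

Lemma opow_gt0 (x a : R) : 0 < x -> opow x a = Rpower x a.
Proof.
  intros Hx. unfold opow. rewrite sign_eq_1, Rabs_pos_eq by lra. ring.
Qed.

Lemma opow_pos (x a : R) : 0 < x -> 0 < opow x a.
Proof. intros Hx. rewrite opow_gt0 by easy. apply exp_pos. Qed.

Lemma opow_0 (a : R) : opow 0 a = 0.
Proof. unfold opow. rewrite sign_0. ring. Qed.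

Lemma opow_opp (x a : R) : opow (- x) a = - opow x a.
Proof. unfold opow. rewrite sign_opp, Rabs_Ropp. ring. Qed.

Lemma opow_neg (x a : R) : x < 0 -> opow x a < 0.
Proof.
  intros Hx. replace x with (- (- x)) by ring. rewrite opow_opp.
  assert (0 < opow (- x) a) by (apply opow_pos; lra). lra.
Qed.

Lemma opow_mult (x y a : R) : opow (x * y) a = opow x a * opow y a.
Proof.
  destruct (Req_dec x 0) as [->|Hx]; [rewrite Rmult_0_l, opow_0; ring|].
  destruct (Req_dec y 0) as [->|Hy]; [rewrite Rmult_0_r, opow_0; ring|].
  unfold opow.
  rewrite sign_mult, Rabs_mult, <- Rpower_mult_distr by now apply Rabs_pos_lt.
  ring.
Qed.

Lemma opow_inv_base (x a : R) : 0 < x -> opow (/ x) a = opow x (- a).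
Proof.
  intros Hx.
  rewrite !opow_gt0 by (try apply Rinv_0_lt_compat; easy).
  unfold Rpower. rewrite ln_Rinv by easy. f_equal. ring.
Qed.

Lemma opow_le (x y a : R) : 0 < a -> x <= y -> opow x a <= opow y a.
Proof.
  assert (Hpos : forall x y, 0 < a -> 0 < x -> x <= y -> opow x a <= opow y a).
  { intros u v Ha Hu Huv. rewrite !opow_gt0 by lra. apply Rle_Rpower_l; lra. }
  intros Ha Hxy.
  destruct (Rtotal_order x 0) as [Hx|[->|Hx]]; [| |now apply Hpos].
  - destruct (Rtotal_order y 0) as [Hy|[->|Hy]].
    + replace x with (- (- x)) by ring. replace y with (- (- y)) by ring.
      rewrite !(opow_opp (- _)). apply Ropp_le_contravar, Hpos; lra.
    + rewrite opow_0. now apply Rlt_le, opow_neg.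
    + apply Rle_trans with 0; apply Rlt_le; [now apply opow_neg|now apply opow_pos].
  - rewrite opow_0. destruct (Req_dec y 0) as [->|Hy].
    + rewrite opow_0. lra.
    + apply Rlt_le, opow_pos. lra.
Qed.

Lemma opow_opowV (x a : R) : a <> 0 -> opow (opow x a) (/ a) = x.
Proof.
  intros Ha.
  assert (Hpos : forall x, 0 < x -> opow (opow x a) (/ a) = x).
  { intros u Hu. rewrite (opow_gt0 u), opow_gt0 by (easy || apply exp_pos).
    rewrite Rpower_mult, Rinv_r, Rpower_1; easy. }
  destruct (Rtotal_order x 0) as [Hx|[->|Hx]]; [| |now apply Hpos].
  - replace x with (- (- x)) by ring.
    rewrite (opow_opp (- x)), opow_opp, Hpos; lra.
  - now rewrite !opow_0.
Qed.

Lemma opow_ge0_inv (x a : R) : 0 <= opow x a -> 0 <= x.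
Proof.
  intros H. apply Rnot_lt_le. intros Hx. apply (opow_neg x a) in Hx. lra.
Qed.

Lemma opow_le0_inv (x a : R) : opow x a <= 0 -> x <= 0.
Proof.
  intros H. apply Rnot_lt_le. intros Hx. apply (opow_pos x a) in Hx. lra.
Qed.

Lemma continuous_opow_pos (x a : R) : 0 < x -> continuous (fun u => opow u a) x.
Proof.
  intros Hx.
  apply continuous_ext_loc with (fun u => Rpower u a).
  - exists (mkposreal x Hx). intros u Hu.
    apply Rabs_lt_between' in Hu. simpl in Hu. symmetry. apply opow_gt0. lra.
  - apply (@ex_derive_continuous R_AbsRing R_NormedModule).
    exists (a * Rpower x (a - 1)).
    apply is_derive_Reals. now apply derivable_pt_lim_power.
Qed.

Lemma continuous_opow (x a : R) : 0 < a -> continuous (fun u => opow u a) x.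
Proof.
  intros Ha. destruct (Rtotal_order x 0) as [Hx|[->|Hx]];
    [| |now apply continuous_opow_pos].
  - apply continuous_ext with (fun u => - opow (- u) a).
    { intros u. rewrite opow_opp. apply Ropp_involutive. }
    apply (@continuous_opp R_UniformSpace R_AbsRing R_NormedModule
             (fun u => opow (- u) a)).
    apply (continuous_comp Ropp (fun u => opow u a)).
    + apply (@continuous_opp R_UniformSpace R_AbsRing R_NormedModule (fun u => u)).
      apply continuous_id.
    + apply continuous_opow_pos. lra.
  - (* at [0], the radius [opow e (/ a)] works; [e] is half of [eps] because
       [opow_le] yields only non-strict bounds *)
    apply filterlim_locally. intros eps. rewrite opow_0.
    set (e := eps / 2). assert (He : 0 < e) by (unfold e; destruct eps; simpl; lra).
    assert (Hd := opow_pos e (/ a) He).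
    exists (mkposreal _ Hd). intros u Hu.
    apply Rabs_lt_between' in Hu. simpl in Hu. apply Rabs_lt_between'.
    assert (Hinv : opow (opow e (/ a)) a = e).
    { rewrite <- (Rinv_inv a) at 2. apply opow_opowV, Rinv_neq_0_compat. lra. }
    assert (H1 : opow u a <= opow (opow e (/ a)) a) by (apply opow_le; lra).
    assert (H2 : opow (- opow e (/ a)) a <= opow u a) by (apply opow_le; lra).
    rewrite opow_opp in H2. rewrite Hinv in H1, H2.
    destruct eps; unfold e in *; simpl in *; lra.
Qed.

(** * Continuity and integration on a half-line *)

(** Prolonging [f] by the constant [f a] to the left of [a] turns continuity
    relative to the half-line into continuity on the whole line. *)
Lemma continuous_clamp (a : R) (f : R -> R) :
  continuous_on (halfline a) f -> forall t, continuous (fun s => f (Rmax a s)) t.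
Proof.
  intros Hf t. apply filterlim_locally. intros eps.
  assert (Ha : halfline a (Rmax a t)) by apply Rmax_l.
  assert (H := proj1 (filterlim_locally _ _) (Hf _ Ha) eps).
  destruct H as [d Hd]. exists d. intros s Hs. apply Hd; [|apply Rmax_l].
  apply Rabs_lt_between' in Hs. apply Rabs_lt_between'. destruct d; simpl in *.
  revert Hs. unfold Rmax. destruct (Rle_dec a s), (Rle_dec a t); lra.
Qed.

Lemma continuous_unclamp (a : R) (f : R -> R) :
  (forall t, continuous (fun s => f (Rmax a s)) t) -> continuous_on (halfline a) f.
Proof.
  intros Hf t Ht. apply filterlim_locally. intros eps.
  destruct (proj1 (filterlim_locally _ _) (Hf t) eps) as [d Hd].
  exists d. intros s Hs Has. specialize (Hd s Hs).
  unfold halfline in *. now rewrite !Rmax_right in Hd by easy.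
Qed.

Lemma continuous_halfline_interior (a t : R) (f : R -> R) :
  continuous_on (halfline a) f -> a < t -> continuous f t.
Proof.
  intros Hf Ht. apply continuous_ext_loc with (fun s => f (Rmax a s)).
  - assert (Hd : 0 < t - a) by lra. exists (mkposreal _ Hd). intros s Hs.
    apply Rabs_lt_between' in Hs. simpl in Hs. rewrite Rmax_right; [easy|lra].
  - now apply continuous_clamp.
Qed.

Lemma continuous_on_mult (a : R) (f g : R -> R) :
  continuous_on (halfline a) f -> continuous_on (halfline a) g ->
  continuous_on (halfline a) (fun t => f t * g t).
Proof.
  intros Hf Hg. apply continuous_unclamp. intros t.
  apply (@continuous_mult R_UniformSpace R_AbsRing); now apply continuous_clamp.
Qed.

Lemma continuous_on_comp (a : R) (f g : R -> R) :
  continuous_on (halfline a) f -> (forall t, a <= t -> continuous g (f t)) ->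
  continuous_on (halfline a) (fun t => g (f t)).
Proof.
  intros Hf Hg. apply continuous_unclamp. intros t.
  apply (continuous_comp (fun s => f (Rmax a s)) g).
  - now apply continuous_clamp.
  - apply Hg, Rmax_l.
Qed.

Lemma ex_RInt_halfline (a s t : R) (f : R -> R) :
  continuous_on (halfline a) f -> a <= s -> s <= t -> ex_RInt f s t.
Proof.
  intros Hf Hs Hst. apply ex_RInt_ext with (fun u => f (Rmax a u)).
  - intros u Hu. rewrite Rmin_left in Hu by easy. now rewrite Rmax_right by lra.
  - apply (@ex_RInt_continuous R_CompleteNormedModule). intros u _. now apply continuous_clamp.
Qed.

Lemma is_derive_RInt_halfline (a t : R) (f : R -> R) :
  continuous_on (halfline a) f -> a < t -> is_derive (RInt f a) t (f t).
Proof.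
  intros Hf Ht. apply is_derive_RInt with a.
  - assert (Hd : 0 < t - a) by lra. exists (mkposreal _ Hd). intros s Hs.
    apply Rabs_lt_between' in Hs. simpl in Hs.
    apply (@RInt_correct R_CompleteNormedModule).
    apply ex_RInt_halfline with a; [easy|lra|lra].
  - now apply continuous_halfline_interior with a.
Qed.

Lemma continuous_on_RInt (a : R) (f : R -> R) :
  continuous_on (halfline a) f -> continuous_on (halfline a) (RInt f a).
Proof.
  intros Hf. apply continuous_unclamp. intros t.
  set (g := fun u => f (Rmax a u)).
  assert (Hg : forall u, continuous g u) by now apply continuous_clamp.
  apply continuous_ext with (fun s => RInt g a (Rmax a s)).
  { intros s. apply RInt_ext. intros u Hu.
    rewrite Rmin_left in Hu by apply Rmax_l.
    unfold g. now rewrite Rmax_right by lra. }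
  apply (continuous_comp (Rmax a) (RInt g a)).
  - apply (continuous_clamp a (fun u => u)). intros u _.
    apply filterlim_filter_le_1 with (2 := filterlim_id _ _).
    intros P HP. now apply filter_le_within.
  - apply (@ex_derive_continuous R_AbsRing R_NormedModule).
    exists (g (Rmax a t)). apply is_derive_RInt with a; [|apply Hg].
    apply filter_forall. intros s. apply (@RInt_correct R_CompleteNormedModule).
    apply (@ex_RInt_continuous R_CompleteNormedModule). intros u _. apply Hg.
Qed.

Lemma RInt_halfline_incr (a s t : R) (f : R -> R) :
  continuous_on (halfline a) f -> (forall u, a <= u -> 0 <= f u) ->
  a <= s -> s <= t -> RInt f a s <= RInt f a t.
Proof.
  intros Hf Hpos Hs Hst.
  assert (H : 0 <= RInt f s t).
  { apply RInt_ge_0; [easy|now apply ex_RInt_halfline with a|].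
    intros u Hu. apply Hpos. lra. }
  rewrite <- (@RInt_Chasles R_CompleteNormedModule f a s t)
    by (apply ex_RInt_halfline with a; (easy || lra)).
  change plus with Rplus. lra.
Qed.

Lemma is_derive_of_D_in (a t : R) (f f' : R -> R) :
  has_derivative_on a f f' -> a < t -> is_derive f t (f' t).
Proof.
  intros Hf Ht. apply is_derive_Reals. intros eps Heps.
  destruct (Hf t (Rlt_le _ _ Ht) eps Heps) as [d [Hd H]].
  assert (Hm : 0 < Rmin d (t - a)) by (apply Rmin_pos; lra).
  exists (mkposreal _ Hm). intros h Hh0 Hh. simpl in Hh.
  assert (H1 := Rmin_l d (t - a)). assert (H2 := Rmin_r d (t - a)).
  specialize (H (t + h)). simpl in H. unfold Rdist in H.
  replace (t + h - t) with h in H by ring. apply H. split; [|lra].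
  apply Rabs_def2 in Hh. split; [unfold halfline; lra|lra].
Qed.

(** * Behaviour at infinity *)

Local Notation at_infty := (Rbar_locally p_infty).

Ltac near_infty H1 H2 :=
  let H := fresh in
  assert (H := filter_and _ _ H1 H2); revert H; apply filter_imp.

Lemma near_infty_gt (a : R) : at_infty (fun t => a < t).
Proof. now exists a. Qed.

Lemma near_infty_after (a : R) (P : R -> Prop) :
  (forall t, a < t -> P t) -> at_infty P.
Proof. now exists a. Qed.

Lemma nonincreasing_near_infty (f f' : R -> R) :
  at_infty (fun t => is_derive f t (f' t)) -> at_infty (fun t => f' t <= 0) ->
  exists M, forall s t, M < s -> s <= t -> f t <= f s.
Proof.
  intros Hd Hs. destruct (filter_and _ _ Hd Hs) as [M HM].
  exists M. intros s t Hs1 Hst.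
  destruct (MVT_gen f s t f') as (c & Hc & Heq).
  - intros u Hu. rewrite Rmin_left in Hu by easy. apply HM. lra.
  - intros u Hu. rewrite Rmin_left in Hu by easy.
    apply continuity_pt_filterlim, (@ex_derive_continuous R_AbsRing R_NormedModule).
    exists (f' u). apply HM. lra.
  - rewrite Rmin_left in Hc by easy.
    assert (f' c <= 0) by (apply HM; lra).
    assert (0 <= - f' c * (t - s)) by (apply Rmult_le_pos; lra). lra.
Qed.

Lemma nondecreasing_near_infty (f f' : R -> R) :
  at_infty (fun t => is_derive f t (f' t)) -> at_infty (fun t => 0 <= f' t) ->
  exists M, forall s t, M < s -> s <= t -> f s <= f t.
Proof.
  intros Hd Hs.
  destruct (nonincreasing_near_infty (fun t => - f t) (fun t => - f' t)) as [M HM].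
  - revert Hd. apply filter_imp. intros t. exact (is_derive_opp f t (f' t)).
  - revert Hs. apply filter_imp. intros t. lra.
  - exists M. intros s t H1 H2. specialize (HM s t H1 H2). simpl in HM. lra.
Qed.

Definition eventually_signed (f : R -> R) : Prop :=
  at_infty (fun t => f t <= 0) \/ at_infty (fun t => 0 <= f t).

Lemma eventually_signed_transfer (f g : R -> R) :
  at_infty (fun t => (f t <= 0 -> g t <= 0) /\ (0 <= f t -> 0 <= g t)) ->
  eventually_signed f -> eventually_signed g.
Proof.
  intros Hfg [Hf|Hf]; [left|right]; near_infty Hfg Hf; tauto.
Qed.

(** A monotone function crosses [0] at most once. *)
Lemma eventually_signed_primitive (f f' : R -> R) :
  at_infty (fun t => is_derive f t (f' t)) -> eventually_signed f' ->
  eventually_signed f.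
Proof.
  intros Hd [Hs|Hs].
  - destruct (nonincreasing_near_infty f f' Hd Hs) as [M HM].
    destruct (classic (exists s, M < s /\ f s <= 0)) as [[s [H1 H2]]|Hno].
    + left. exists s. intros t Ht. apply Rle_trans with (f s); [apply HM; lra|easy].
    + right. exists M. intros t Ht. apply Rnot_lt_le. intros H.
      apply Hno. exists t. lra.
  - destruct (nondecreasing_near_infty f f' Hd Hs) as [M HM].
    destruct (classic (exists s, M < s /\ 0 <= f s)) as [[s [H1 H2]]|Hno].
    + right. exists s. intros t Ht. apply Rle_trans with (f s); [easy|apply HM; lra].
    + left. exists M. intros t Ht. apply Rnot_lt_le. intros H.
      apply Hno. exists t. lra.
Qed.

Lemma positive_monotone_dichotomy (f f' : R -> R) :
  at_infty (fun t => is_derive f t (f' t)) -> eventually_signed f' ->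
  at_infty (fun t => 0 < f t) ->
  is_lim f p_infty 0 \/ exists c, 0 < c /\ at_infty (fun t => c <= f t).
Proof.
  intros Hd Hs [T HT].
  destruct (classic (exists c, 0 < c /\ at_infty (fun t => c <= f t)))
    as [Hc|Hno]; [now right|left].
  destruct Hs as [Hs|Hs].
  - destruct (nonincreasing_near_infty f f' Hd Hs) as [M HM].
    apply is_lim_spec. intros eps. apply NNPP. intros Hlim. apply Hno.
    exists eps. split; [apply cond_pos|]. exists (Rmax M T). intros t Ht.
    assert (H1 := Rmax_l M T). assert (H2 := Rmax_r M T).
    apply Rnot_lt_le. intros Hlt. apply Hlim. exists t. intros s Hs1.
    assert (0 < f s) by (apply HT; lra).
    rewrite Rminus_0_r, Rabs_pos_eq by lra.
    apply Rle_lt_trans with (f t); [apply HM; lra|easy].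
  - destruct (nondecreasing_near_infty f f' Hd Hs) as [M HM].
    exfalso. apply Hno. set (s := Rmax M T + 1).
    assert (H1 := Rmax_l M T). assert (H2 := Rmax_r M T).
    exists (f s). split; [apply HT; unfold s; lra|].
    exists s. intros t Ht. apply HM; unfold s in *; lra.
Qed.

(** * Comparison with divergent integrals *)

(** The divergence of [F] pays for the constant of integration: half of [k F]
    eventually exceeds it. *)
Lemma derivative_bound_integrated (f f' F w : R -> R) (k : R) :
  0 < k ->
  at_infty (fun t => is_derive f t (f' t)) ->
  at_infty (fun t => is_derive F t (w t)) ->
  is_lim F p_infty p_infty ->
  at_infty (fun t => f' t <= - k * w t) ->
  exists k', 0 < k' /\ at_infty (fun t => f t <= - k' * F t).
Proof.
  intros Hk Hf HF Hlim Hle.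
  destruct (nonincreasing_near_infty (fun t => f t + k * F t)
              (fun t => f' t + k * w t)) as [M HM].
  - near_infty Hf HF. intros t [H1 H2].
    apply (is_derive_plus f (fun t => k * F t)); [easy|].
    now apply is_derive_scal.
  - revert Hle. apply filter_imp. intros t. lra.
  - exists (k / 2). split; [lra|].
    set (s := M + 1). set (C := f s + k * F s).
    assert (HC := proj2 (is_lim_spec _ _ _) Hlim (2 * C / k)).
    near_infty HC (near_infty_gt s). intros t [H1 H2].
    assert (H3 : f t + k * F t <= C) by (apply HM; unfold s in *; lra).
    assert (H4 : k / 2 * (2 * C / k) <= k / 2 * F t)
      by (apply Rmult_le_compat_l; lra).
    replace (k / 2 * (2 * C / k)) with C in H4 by (field; lra). lra.
Qed.

(** The root [opow _ (/ a)] is odd, increasing and multiplicative, so it carries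
    a bound on [r x^a] to one on [x] of the same form, with weight [r^(-1/a)]. *)
Lemma solve_bound (a r x g k : R) :
  0 < a -> 0 < r -> r * opow x a <= - k * g ->
  x <= - opow k (/ a) * (opow r (- / a) * opow g (/ a)).
Proof.
  intros Ha Hr H.
  assert (Hra := Rinv_0_lt_compat _ Hr).
  assert (H1 : opow x a <= - (k * (/ r * g))).
  { apply Rmult_le_reg_l with r; [easy|]. field_simplify; lra. }
  apply (opow_le _ _ (/ a)) in H1; [|now apply Rinv_0_lt_compat].
  rewrite opow_opowV, opow_opp, !opow_mult, opow_inv_base in H1 by lra. lra.
Qed.

(** If [g] were bounded by [M], the integral would be at most
    [opow M (/ a)] times the finite integral of the weight [r^(-1/a)]. *)
Lemma weighted_divergence (t0 a : R) (r g : R -> R) :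
  0 < a ->
  continuous_on (halfline t0) r -> (forall t, t0 <= t -> 0 < r t) ->
  ex_RInt_gen (fun s => opow (r s) (- / a)) (at_point t0) at_infty ->
  continuous_on (halfline t0) g ->
  (forall s t, t0 <= s -> s <= t -> g s <= g t) ->
  is_lim (RInt (fun s => opow (r s) (- / a) * opow (g s) (/ a)) t0) p_infty p_infty ->
  is_lim g p_infty p_infty.
Proof.
  intros Ha Hr Hrpos [l Hl] Hg Hmono Hdiv.
  assert (Hia : 0 < / a) by now apply Rinv_0_lt_compat.
  assert (Hw : continuous_on (halfline t0) (fun s => opow (r s) (- / a))).
  { apply (continuous_on_comp t0 r (fun u => opow u (- / a))); [easy|].
    intros t Ht. apply continuous_opow_pos. now apply Hrpos. }
  assert (Hgw : continuous_on (halfline t0) (fun s => opow (g s) (/ a))).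
  { apply (continuous_on_comp t0 g (fun u => opow u (/ a))); [easy|].
    intros t Ht. now apply continuous_opow. }
  assert (Hbound : exists N, 0 < N /\
            at_infty (fun T => RInt (fun s => opow (r s) (- / a)) t0 T <= N)).
  { destruct (Hl _ (locally_ball l (mkposreal 1 Rlt_0_1))) as [P Q HP HQ HPQ].
    exists (Rabs l + 1). split; [assert (H := Rabs_pos l); lra|].
    revert HQ. apply filter_imp. intros T HT.
    destruct (HPQ t0 T HP HT) as (x & Hx & Hball). simpl in Hx.
    rewrite (is_RInt_unique _ _ _ _ Hx).
    apply Rabs_lt_between' in Hball. simpl in Hball.
    assert (H := Rle_abs l). lra. }
  destruct Hbound as (N & HN & HNle).
  apply is_lim_spec. intros M0. set (M := Rmax M0 1).
  assert (HM1 : 1 <= M) by apply Rmax_r. assert (HM0 : M0 <= M) by apply Rmax_l.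
  destruct (classic (exists s, t0 <= s /\ M < g s)) as [[s [Hs1 Hs2]]|Hno].
  { exists s. intros t Ht. assert (g s <= g t) by (apply Hmono; lra). lra. }
  exfalso.
  assert (Hle : forall s, t0 <= s -> g s <= M).
  { intros s Hs. apply Rnot_lt_le. intros H. apply Hno. now exists s. }
  assert (HK := opow_pos M (/ a) ltac:(lra)). set (K := opow M (/ a)) in *.
  assert (Hbig := proj2 (is_lim_spec _ _ _) Hdiv (K * N)).
  destruct (filter_and _ _ (filter_and _ _ Hbig HNle) (near_infty_gt t0)) as [T HT].
  destruct (HT (T + 1) ltac:(lra)) as [[H1 H2] H3].
  set (S := T + 1) in *.
  assert (H4 : RInt (fun s => opow (r s) (- / a) * opow (g s) (/ a)) t0 S
               <= RInt (fun s => K * opow (r s) (- / a)) t0 S).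
  { apply RInt_le; [lra| | |].
    - apply ex_RInt_halfline with t0; [now apply continuous_on_mult|lra|lra].
    - apply (@ex_RInt_scal R_NormedModule).
      apply ex_RInt_halfline with t0; [easy|lra|lra].
    - intros s Hs. rewrite Rmult_comm. apply Rmult_le_compat_r.
      + apply Rlt_le, opow_pos, Hrpos. lra.
      + apply opow_le; [easy|]. apply Hle. lra. }
  rewrite (@RInt_scal R_CompleteNormedModule) in H4
    by (apply ex_RInt_halfline with t0; [easy|lra|lra]).
  change (scal K ?x) with (K * x) in H4.
  assert (K * RInt (fun s => opow (r s) (- / a)) t0 S <= K * N)
    by (apply Rmult_le_compat_l; lra).
  lra.
Qed.

(** * Nonoscillatory solutions *)

(** [Q], [W1] and [W2] are the nested integrals of the divergence hypothesis,
    given by their derivatives, so that each pairs with one integration of the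
    equation: [Q] with [L2], [W1] with [L1] and [W2] with [y]. *)
Lemma positive_solution_tends_to_0 (alpha beta gamma : R)
    (r1 r2 q sigma Q W1 W2 y y' L1' L2' : R -> R) :
  0 < alpha -> 0 < beta -> 0 < gamma ->
  at_infty (fun t => 0 < r1 t) -> at_infty (fun t => 0 < r2 t) ->
  at_infty (fun t => 0 <= q t) -> at_infty (fun t => t <= sigma t) ->
  at_infty (fun t => is_derive Q t (q t)) ->
  at_infty (fun t => is_derive W1 t (opow (r2 t) (- / beta) * opow (Q t) (/ beta))) ->
  at_infty (fun t =>
    is_derive W2 t (opow (r1 t) (- / alpha) * opow (W1 t) (/ alpha))) ->
  is_lim Q p_infty p_infty -> is_lim W1 p_infty p_infty ->
  is_lim W2 p_infty p_infty ->
  at_infty (fun t => is_derive y t (y' t)) ->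
  at_infty (fun t => is_derive (fun s => r1 s * opow (y' s) alpha) t (L1' t)) ->
  at_infty (fun t => is_derive (fun s => r2 s * opow (L1' s) beta) t (L2' t)) ->
  at_infty (fun t => L2' t + q t * opow (y (sigma t)) gamma = 0) ->
  at_infty (fun t => 0 < y t) ->
  is_lim y p_infty 0.
Proof.
  intros Ha Hb Hc Hr1 Hr2 Hq Hsig HQ HW1 HW2 LQ LW1 LW2 Hy HL1 HL2 Heq Hypos.
  assert (Hdelay : forall c, at_infty (fun t => c <= y t) ->
                     at_infty (fun t => c <= y (sigma t))).
  { intros c [M HM]. near_infty Hsig (near_infty_gt M).
    intros t [H1 H2]. apply HM. lra. }
  assert (Hdecr : forall c, 0 <= c -> at_infty (fun t => c <= y t) ->
                    at_infty (fun t => L2' t <= - opow c gamma * q t)).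
  { intros c Hc0 Hyc. near_infty Heq (filter_and _ _ Hq (Hdelay c Hyc)).
    intros t (E & Hqt & Hyt).
    assert (q t * opow c gamma <= q t * opow (y (sigma t)) gamma)
      by (apply Rmult_le_compat_l; [easy|now apply opow_le]).
    lra. }
  assert (Hfactor : forall a r f, at_infty (fun t => 0 < r t) ->
            eventually_signed (fun t => r t * opow (f t) a) -> eventually_signed f).
  { intros a r f Hr. apply eventually_signed_transfer.
    revert Hr. apply filter_imp. intros t Hr. split; intros H.
    - apply opow_le0_inv with a, Rmult_le_reg_l with (r t); lra.
    - apply opow_ge0_inv with a, Rmult_le_reg_l with (r t); lra. }
  assert (S2 : eventually_signed L2').
  { left. assert (Hy0 : at_infty (fun t => 0 <= y t))
      by (revert Hypos; apply filter_imp; intros; lra).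
    generalize (Hdecr 0 (Rle_refl 0) Hy0). apply filter_imp. intros t.
    rewrite opow_0. lra. }
  assert (S1 : eventually_signed y').
  { apply (Hfactor alpha r1 y' Hr1), eventually_signed_primitive with (1 := HL1).
    apply (Hfactor beta r2 L1' Hr2).
    now apply eventually_signed_primitive with (1 := HL2). }
  destruct (positive_monotone_dichotomy y y' Hy S1 Hypos) as [H|(c & Hcpos & Hyc)];
    [easy|exfalso].
  assert (B2 := Hdecr c (Rlt_le _ _ Hcpos) Hyc).
  destruct (derivative_bound_integrated _ _ _ _ _ (opow_pos c gamma Hcpos)
              HL2 HQ LQ B2) as (k2 & Hk2 & B2').
  assert (B1 : at_infty (fun t => L1' t <= - opow k2 (/ beta) *
                 (opow (r2 t) (- / beta) * opow (Q t) (/ beta)))).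
  { near_infty Hr2 B2'. intros t [H1 H2]. now apply solve_bound. }
  destruct (derivative_bound_integrated _ _ _ _ _ (opow_pos k2 (/ beta) Hk2)
              HL1 HW1 LW1 B1) as (k1 & Hk1 & B1').
  assert (B0 : at_infty (fun t => y' t <= - opow k1 (/ alpha) *
                 (opow (r1 t) (- / alpha) * opow (W1 t) (/ alpha)))).
  { near_infty Hr1 B1'. intros t [H1 H2]. now apply solve_bound. }
  destruct (derivative_bound_integrated _ _ _ _ _ (opow_pos k1 (/ alpha) Hk1)
              Hy HW2 LW2 B0) as (k0 & Hk0 & B0').
  assert (HF := proj2 (is_lim_spec _ _ _) LW2 0).
  destruct (filter_and _ _ (filter_and _ _ HF B0') Hypos) as [M HM].
  destruct (HM (M + 1) ltac:(lra)) as [[H1 H2] H3].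
  assert (0 < k0 * W2 (M + 1)) by now apply Rmult_lt_0_compat. lra.
Qed.

Lemma nonvanishing_eventually_signed (y : R -> R) :
  at_infty (fun t => continuous y t) -> at_infty (fun t => y t <> 0) ->
  at_infty (fun t => 0 < y t) \/ at_infty (fun t => 0 < - y t).
Proof.
  intros Hcont Hnz. destruct (filter_and _ _ Hcont Hnz) as [M HM].
  assert (Hivt : forall f : R -> R, (forall t, M < t -> continuous f t /\ f t <> 0) ->
            forall s t, M < s -> s < t -> f s < 0 -> f t < 0).
  { intros f Hf s t Hs Hst Hfs. destruct (Hf t ltac:(lra)) as [_ Hft].
    apply Rnot_le_lt. intros Hpos.
    destruct (IVT_interv f s t) as (z & Hz & Hz0); [|easy|easy|lra|].
    - intros u Hu. apply continuity_pt_filterlim, Hf. lra.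
    - apply (Hf z); [lra|easy]. }
  set (s := M + 1). destruct (HM s ltac:(unfold s; lra)) as [_ Hs].
  destruct (Rlt_le_dec (y s) 0) as [Hneg|Hpos]; [right|left]; exists s; intros t Ht.
  - assert (y t < 0) by (apply (Hivt y HM s t); unfold s in *; lra). lra.
  - assert (- y t < 0); [|lra].
    apply (Hivt (fun u => - y u)) with s; try (unfold s in *; lra).
    intros u Hu. destruct (HM u Hu) as [H1 H2]. split; [|lra].
    exact (continuous_opp y u H1).
Qed.

Theorem theorem2p4 (t0 alpha beta gamma : R) (r1 r2 q sigma sigma' : R -> R)
  (ht0 : 0 < t0)
  (halpha : odd_quotient alpha) (hbeta : odd_quotient beta)
  (hgamma : odd_quotient gamma)
  (hr1 : continuous_on (halfline t0) r1)
  (hr1_pos : forall t, t0 <= t -> 0 < r1 t)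
  (hr2 : continuous_on (halfline t0) r2)
  (hr2_pos : forall t, t0 <= t -> 0 < r2 t)
  (hr1_int : ex_RInt_gen (fun s => opow (r1 s) (- / alpha))
               (at_point t0) (Rbar_locally p_infty))
  (hr2_int : ex_RInt_gen (fun s => opow (r2 s) (- / beta))
               (at_point t0) (Rbar_locally p_infty))
  (hq : continuous_on (halfline t0) q)
  (hq_nonneg : forall t, t0 <= t -> 0 <= q t)
  (hq_nonvanishing : forall T, t0 <= T -> exists t, T <= t /\ q t <> 0)
  (hsigma : has_derivative_on t0 sigma sigma')
  (hsigma' : continuous_on (halfline t0) sigma')
  (hsigma_pos : forall t, t0 <= t -> 0 < sigma t)
  (hsigma_adv : forall t, t0 <= t -> t <= sigma t)
  (hsigma'_nonneg : forall t, t0 <= t -> 0 <= sigma' t)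
  (hsolutions : exists (Ty : R) (y : R -> R),
     is_proper_solution t0 alpha beta gamma r1 r2 q sigma Ty y)
  (hdiv : is_lim (fun T => RInt (fun v =>
              opow (r1 v) (- / alpha)
              * opow (inner_integral t0 beta r2 q v) (/ alpha)) t0 T)
            p_infty p_infty)
  (hlimsup : Rbar_lt 1 (LimSup_infty (fun t =>
       opow (pi_tail r1 alpha (sigma t)) (gamma / beta)
       * inner_integral t0 beta r2 q t)))
  (hexp : gamma = alpha * beta) :
  property_A t0 alpha beta gamma r1 r2 q sigma.
Proof.
  assert (Ha := odd_quotient_pos _ halpha). assert (Hb := odd_quotient_pos _ hbeta).
  assert (Hc := odd_quotient_pos _ hgamma).
  set (Q := RInt q t0).
  set (w1 := fun u => opow (r2 u) (- / beta) * opow (Q u) (/ beta)).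
  change (inner_integral t0 beta r2 q) with (RInt w1 t0) in *.
  set (W1 := RInt w1 t0) in *.
  set (w2 := fun v => opow (r1 v) (- / alpha) * opow (W1 v) (/ alpha)) in *.
  change (is_lim (RInt w2 t0) p_infty p_infty) in hdiv.
  assert (Hweight : forall a r g, 0 < a ->
            continuous_on (halfline t0) r -> (forall t, t0 <= t -> 0 < r t) ->
            continuous_on (halfline t0) g ->
            continuous_on (halfline t0)
              (fun u => opow (r u) (- / a) * opow (g u) (/ a))).
  { intros a r g Hpa Hr Hrp Hg. apply continuous_on_mult.
    - apply (continuous_on_comp t0 r (fun u => opow u (- / a))); [easy|].
      intros t Ht. apply continuous_opow_pos. now apply Hrp.
    - apply (continuous_on_comp t0 g (fun u => opow u (/ a))); [easy|].
      intros t Ht. now apply continuous_opow, Rinv_0_lt_compat. }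
  assert (CQ : continuous_on (halfline t0) Q) by now apply continuous_on_RInt.
  assert (Cw1 : continuous_on (halfline t0) w1) by now apply Hweight.
  assert (CW1 : continuous_on (halfline t0) W1) by now apply continuous_on_RInt.
  assert (Cw2 : continuous_on (halfline t0) w2) by now apply Hweight.
  assert (Qmono : forall s t, t0 <= s -> s <= t -> Q s <= Q t).
  { intros s t Hs Hst. now apply RInt_halfline_incr. }
  assert (w1pos : forall u, t0 <= u -> 0 <= w1 u).
  { intros u Hu. apply Rmult_le_pos.
    - now apply Rlt_le, opow_pos, hr2_pos.
    - rewrite <- (opow_0 (/ beta)). apply opow_le; [now apply Rinv_0_lt_compat|].
      apply Rle_trans with (Q t0); [|apply Qmono; lra].
      unfold Q. rewrite RInt_point. apply Rle_refl. }
  assert (LW1 : is_lim W1 p_infty p_infty).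
  { apply weighted_divergence with t0 alpha r1; try easy.
    intros s t Hs Hst. now apply RInt_halfline_incr. }
  assert (LQ : is_lim Q p_infty p_infty)
    by now apply weighted_divergence with t0 beta r2.
  intros Ty y ((HTy & _ & y' & L1' & L2' & Hcy & Hy & _ & HL1 & _ & HL2 & Heq) & _).
  destruct (classic (oscillatory Ty y)) as [Hosc|Hosc]; [now left|right].
  assert (Hnz : at_infty (fun t => y t <> 0)).
  { apply not_all_ex_not in Hosc. destruct Hosc as [T HT].
    exists (Rmax T Ty). intros t Ht Hyt. apply HT. exists t.
    assert (H1 := Rmax_l T Ty). assert (H2 := Rmax_r T Ty). repeat split; lra. }
  assert (Hlim : forall z z' M1' M2' : R -> R,
    has_derivative_on Ty z z' ->
    has_derivative_on Ty (fun t => r1 t * opow (z' t) alpha) M1' ->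
    has_derivative_on Ty (fun t => r2 t * opow (M1' t) beta) M2' ->
    (forall t, Ty <= t -> M2' t + q t * opow (z (sigma t)) gamma = 0) ->
    at_infty (fun t => 0 < z t) -> is_lim z p_infty 0).
  { intros z z' M1' M2' D0 D1 D2 E Hpos.
    apply positive_solution_tends_to_0 with alpha beta gamma r1 r2 q sigma
      Q W1 (RInt w2 t0) z' M1' M2'; try easy;
      (apply near_infty_after with Ty; intros t Ht).
    - apply hr1_pos. lra.
    - apply hr2_pos. lra.
    - apply hq_nonneg. lra.
    - apply hsigma_adv. lra.
    - exact (is_derive_RInt_halfline t0 t q hq ltac:(lra)).
    - exact (is_derive_RInt_halfline t0 t w1 Cw1 ltac:(lra)).
    - exact (is_derive_RInt_halfline t0 t w2 Cw2 ltac:(lra)).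
    - now apply is_derive_of_D_in with Ty.
    - now apply is_derive_of_D_in with Ty.
    - now apply is_derive_of_D_in with Ty.
    - apply E. lra. }
  destruct (nonvanishing_eventually_signed y) as [Hpos|Hneg]; [|easy| |].
  - apply near_infty_after with Ty. intros t Ht.
    now apply continuous_halfline_interior with Ty.
  - now apply Hlim with y' L1' L2'.
  - (* all the powers are odd functions, so [- y] solves the same equation *)
    assert (Hopp : forall f f' g : R -> R, has_derivative_on Ty f f' ->
              (forall t, g t = - f t) -> has_derivative_on Ty g (fun t => - f' t)).
    { intros f f' g Hf Hg t Ht eps Heps.
      destruct (Hf t Ht eps Heps) as (d & Hd & H). exists d. split; [easy|].
      intros s Hs. specialize (H s Hs). simpl in *. unfold Rdist in *.
      rewrite !Hg, <- Rabs_Ropp.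
      replace (- ((- f s - - f t) / (s - t) - - f' t))
        with ((f s - f t) / (s - t) - f' t); [easy|].
      unfold Rdiv. ring. }
    assert (Hm : is_lim (fun t => - y t) p_infty 0).
    { apply Hlim with (fun t => - y' t) (fun t => - L1' t) (fun t => - L2' t).
      - now apply Hopp with y.
      - apply Hopp with (1 := HL1). intros t. rewrite opow_opp. ring.
      - apply Hopp with (1 := HL2). intros t. rewrite opow_opp. ring.
      - intros t Ht. rewrite opow_opp. specialize (Heq t Ht). lra.
      - easy. }
    apply is_lim_opp in Hm. simpl in Hm. rewrite Ropp_0 in Hm.
    apply is_lim_ext with (2 := Hm). intros t. apply Ropp_involutive.
Qed.
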